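(* The Wasserstein-robust optimization problem $$\text{(WRO)}\qquad \inf_{\theta\in\Theta}\ \sup_{P\in\mathcal{P}}\ \mathbb{E}_P[h(\theta,\xi)]$$ is equivalent (same optimal value and same optimal decisions $\theta$) to the following semi-infinite program: $$ \begin{array}{cll} \min_{\theta,v} & \displaystyle\frac1m\sum_{i=1}^m v_i+r_0\,v_{m+1} & \\ \text{s.t.} & h(\theta,s)-v_i-v_{m+1}\,d(s,\xi^i)\le 0, & s\in\Xi,\ i\in[m],\\ & \theta\in\Theta,\ v\in\mathcal{H}. & \end{array} $$
   Context: Setting. $[m]=\{1,\dots,m\}$. $(\Xi,\mathcal{F})$ is a measurable space, where $\Xi\subseteq\mathbb{R}^n$ and $\mathcal{F}$ is a $\sigma$-algebra containing all singletons of $\Xi$. $\mathcal{M}(\Xi,\mathcal{F})$ is the set of all probability distributions on $(\Xi,\mathcal{F})$. $d(\cdot,\cdot)$ is a metric on $\Xi$, measurable with respect to $\mathcal{F}\times\mathcal{F}$. For $P_1,P_2\in\mathcal{M}(\Xi,\mathcal{F})$ the $L_1$-Wasserstein metric is $$\mathcal{W}(P_1,P_2)=\inf_{K\in\mathcal{S}(P_1,P_2)}\int_{\Xi\times\Xi}d(s_1,s_2)\,K(ds_1\times ds_2),$$ where $\mathcal{S}(P_1,P_2)$ is the set of probability measures $K$ on $(\Xi\times\Xi,\mathcal{F}\times\mathcal{F})$ with $K(A\times\Xi)=P_1(A)$ and $K(\Xi\times A)=P_2(A)$ for all $A\in\mathcal{F}$. The points $\xi^1,\dots,\xi^m\in\Xi$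 are (distinct) observed samples, $P_0$ is the empirical distribution $P_0(\{\xi^i\})=1/m$, $i\in[m]$, and $\mathcal{P}=\{P\in\mathcal{M}(\Xi,\mathcal{F}):\mathcal{W}(P,P_0)\le r_0\}$. Standing assumptions: $r_0>0$; $\Theta\subseteq\mathbb{R}^n$ and $\Xi$ are compact; $h:\Theta\times\Xi\to\mathbb{R}$ is continuous in $\theta$ and bounded on $\Theta\times\Xi$; for every $\theta\in\Theta$ there exists $C(\theta)>0$ with $|h(\theta,s_1)-h(\theta,s_2)|\le C(\theta)\,d(s_1,s_2)$ for all $s_1,s_2\in\Xi$. With $C_1$ and $C_2$ lower and upper bounds of $h$ on $\Theta\times\Xi$, respectively, $$\mathcal{H}=\Big\{v\in\mathbb{R}^{m+1}:\ C_1\le v_i\le (m+1)C_2-mC_1\ \text{for } i\in[m],\quad 0\le v_{m+1}\le (C_2-C_1)/r_0\Big\}.$$ *)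

(* Defs.v *)
From HB Require Import structures.
From mathcomp Require Import all_boot all_order all_algebra.
From mathcomp Require Import all_classical all_reals all_analysis.

Set Implicit Arguments.
Unset Strict Implicit.
Unset Printing Implicit Defensive.

Import Order.TTheory GRing.Theory Num.Theory.
Import numFieldNormedType.Exports.

Local Open Scope classical_set_scope.
Local Open Scope ring_scope.

(* The measurable space (Xi, F) for a subset Xi of an ambient type. Its
   carrier is Xi itself and [measurable] is convertible to F. The library
   requires measurable types to be pointed, hence the argument Xi0; the chosen
   point plays no other role. *)
Definition sample_space (U : choiceType) (Xi : set U) (F : set (set Xi))
  (Xi0 : Xi !=set0) (hF : sigma_algebra [set: Xi] F) : Type := Xi.

Section sample_space_measurable.
Context (U : choiceType) (Xi : set U) (F : set (set Xi)).
Context (Xi0 : Xi !=set0) (hF : sigma_algebra [set: Xi] F).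

Let T := sample_space Xi0 hF.

Let sample_measurable : set (set T) := F.

Let sample_measurable0 : sample_measurable set0.
Proof. by case: hF. Qed.

Let sample_measurableC A : sample_measurable A -> sample_measurable (~` A).
Proof. by case: hF => _ hC _ /hC; rewrite setTD. Qed.

Let sample_measurable_bigcup (A : (set T)^nat) :
  (forall i, sample_measurable (A i)) -> sample_measurable (\bigcup_i A i).
Proof. by case: hF => _ _; exact. Qed.

HB.instance Definition _ := Choice.copy T Xi.
HB.instance Definition _ :=
  isPointed.Build T (SigSub (mem_set (projT2 (cid Xi0)))).
HB.instance Definition _ := @isMeasurable.Build (sigma_display F) T
  sample_measurable sample_measurable0 sample_measurableC
  sample_measurable_bigcup.

End sample_space_measurable.

Section wasserstein.
Context {disp : measure_display} {T : measurableType disp} {R : realType}.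
Local Open Scope ereal_scope.

Definition is_metric (d : T -> T -> R) : Prop :=
  [/\ forall x y, (0 <= d x y)%R,
      forall x y, d x y = 0%R <-> x = y,
      forall x y, d x y = d y x &
      forall x y z, (d x z <= d x y + d y z)%R].

Definition couplings (P1 P2 : probability T R) : set (probability (T * T)%type R) :=
  [set K | forall A : set T, measurable A ->
             K (A `*` setT) = P1 A /\ K (setT `*` A) = P2 A].

Definition wasserstein (d : T -> T -> R) (P1 P2 : probability T R) : \bar R :=
  ereal_inf [set \int[K]_z (d z.1 z.2)%:E | K in couplings P1 P2].

Definition wasserstein_ball (d : T -> T -> R) (P0 : probability T R) (r0 : R) :
    set (probability T R) :=
  [set P | wasserstein d P P0 <= r0%:E].

Definition worst_case {V : Type} (h : V -> T -> R)
    (B : set (probability T R)) (theta : V) : \bar R :=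
  ereal_sup [set 'E_P[h theta] | P in B].

End wasserstein.

Section optimization.
Context {R : realType} {V : Type}.

Definition optimal_value (D : set V) (f : V -> \bar R) : \bar R :=
  ereal_inf (f @` D).

Definition optimal_solution (D : set V) (f : V -> \bar R) (x : V) : Prop :=
  D x /\ forall y, D y -> (f x <= f y)%E.

End optimization.

Section semi_infinite_program.
Context {R : realType} {m : nat}.

(* A vector v in R^(m+1) splits into its first m coordinates, indexed by the
   samples, and its last coordinate, the multiplier of the Wasserstein
   constraint. *)
Definition v_sample (v : 'rV[R]_m.+1) (i : 'I_m) : R :=
  v ord0 (widen_ord (leqnSn m) i).

Definition v_last (v : 'rV[R]_m.+1) : R := v ord0 ord_max.

Definition dual_box (C1 C2 r0 : R) : set 'rV[R]_m.+1 :=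
  [set v | (forall i : 'I_m,
              C1 <= v_sample v i <= m.+1%:R * C2 - m%:R * C1) /\
           0 <= v_last v <= (C2 - C1) / r0].

Definition sip_feasible {V T : Type} (Theta : set V) (h : V -> T -> R)
    (d : T -> T -> R) (xi : 'I_m -> T) (C1 C2 r0 : R) :
    set (V * 'rV[R]_m.+1) :=
  [set x | [/\ forall (s : T) (i : 'I_m),
                 h x.1 s - v_sample x.2 i - v_last x.2 * d s (xi i) <= 0,
               Theta x.1 & dual_box C1 C2 r0 x.2]].

Definition sip_objective {V : Type} (r0 : R) (x : V * 'rV[R]_m.+1) : \bar R :=
  (m%:R^-1 * \sum_(i < m) v_sample x.2 i + r0 * v_last x.2)%:E.

End semi_infinite_program.

(* Main.v *)
(* Strong duality for a fixed decision theta, with h theta written f. If v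
   and lam satisfy the constraints, integrating
   f s <= v_i + lam d(s, xi_i) against an almost optimal coupling of P and P0
   bounds E_P[f] by the dual objective. Conversely, let V be the worst-case
   value. A choice s = (s_i) of one point per sample has a cost
   c(s) = (1/m) sum_i d(s_i, xi_i) and a payoff y(s) = (1/m) sum_i f(s_i), and
   a mixture of two choices whose mean cost is at most r0 is a discrete
   distribution in the ball, so its payoff is at most V. Comparing the slopes
   (y - V) / (c - r0) on both sides of c = r0 yields lam >= 0 with
   y(s) + lam (r0 - c(s)) <= V for every s; this decouples over the samples
   and v_i = sup_s (f s - lam d(s, xi_i)) is dual feasible with objective at
   most V. Attainment in the program follows from compactness of its feasible
   set. *)
Require Import Defs.
From HB Require Import structures.
From mathcomp Require Import all_boot all_order all_algebra.
From mathcomp Require Import all_classical all_reals all_analysis.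
From mathcomp Require Import measurable_realfun ring lra.

Set Implicit Arguments.
Unset Strict Implicit.
Unset Printing Implicit Defensive.

Import Order.TTheory GRing.Theory Num.Theory.
Import numFieldNormedType.Exports.

Local Open Scope classical_set_scope.
Local Open Scope ring_scope.

(** * Integrals and measurability without regularity of the integrand *)

(* No measurability is required: the integral is a difference of suprema over
   simple functions below the positive and negative parts. *)
Lemma le_integral_pointwise disp (T : measurableType disp) (R : realType)
    (mu : {measure set T -> \bar R}) (f g : T -> \bar R) :
  (forall x, (f x <= g x)%E) -> (\int[mu]_x f x <= \int[mu]_x g x)%E.
Proof.
move=> fg.
have le_ge0 (f1 g1 : T -> \bar R) : (forall x, (0 <= f1 x)%E) ->
    (forall x, (f1 x <= g1 x)%E) -> (\int[mu]_x f1 x <= \int[mu]_x g1 x)%E.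
  move=> f0 fg1; rewrite !ge0_integralTE//; last first.
    by move=> x; exact: le_trans (fg1 x).
  apply: ereal_sup_le => _ [k /= kf <-]; exists k => // x.
  exact: le_trans (fg1 x).
rewrite integralE [leRHS]integralE; apply: leeB; apply: le_ge0 => // x.
- by apply: (@funepos_le _ _ setT) => //; rewrite in_setT.
- by apply: (@funeneg_le _ _ setT) => //; rewrite in_setT.
Qed.

(** Countable sets are measurable once singletons are, and a preimage is a subset of [S] together
    with either nothing or all of the complement of [S]. *)
Lemma measurable_fun_cst_off disp (T : measurableType disp) (R : realType)
    (f : T -> R) (S : set T) (c : R) :
  (forall t : T, measurable [set t]) -> countable S ->
  (forall x, ~ S x -> f x = c) -> measurable_fun setT f.
Proof.
move=> m1 cS fc _ Y mY; rewrite setTI.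
have -> : f @^-1` Y = (S `&` f @^-1` Y) `|` (~` S `&` [set _ | Y c]).
  apply/seteqP; split=> x /=.
    by move=> Yx; have [Sx|Sx] := pselect (S x); [left|right; rewrite -(fc x)].
  by case=> [[]//|[Sx]]; rewrite fc.
apply: measurableU.
  apply: countable_measurable => //.
  by apply: sub_countable cS; apply: subset_card_le => t [].
apply: measurableI; first exact/measurableC/countable_measurable.
have [Yc|Yc] := pselect (Y c).
  by rewrite (_ : mkset _ = setT)//; apply/seteqP; split.
by rewrite (_ : mkset _ = set0)//; apply/seteqP; split.
Qed.

(** * Finitely supported probability measures *)

Section discrete_probability.
Context disp (T : measurableType disp) (R : realType) (I : finType).
Variables (w : I -> {nonneg R}) (x : I -> T).

(** [msum] sums over natural numbers, so [I] is enumerated and the zero measure fills the indices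
    beyond [#|I|]. *)
Definition discrete_summand (k : nat) : {measure set T -> \bar R} :=
  if insub k is Some j
  then mscale (w (enum_val (j : 'I_#|I|))) \d_(x (enum_val j))
  else mzero.

(** The proof of unit mass is an argument so that the probability structure can be attached to the
    term itself. *)
Definition discrete_probability of \sum_i (w i)%:num = 1 : set T -> \bar R :=
  msum discrete_summand #|I|.

Hypothesis w1 : \sum_i (w i)%:num = 1.

HB.instance Definition _ := Measure.on (discrete_probability w1).

Lemma discrete_probabilityE A :
  discrete_probability w1 A = (\sum_i (w i)%:num * \1_A (x i))%:E.
Proof.
rewrite /discrete_probability /msum -sumEFin.
rewrite [RHS](reindex _ (onW_bij _ (@enum_val_bij I))).
by apply: eq_bigr => k _; rewrite /discrete_summand valK.
Qed.

Let discrete_probability_setT : discrete_probability w1 setT = 1%E.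
Proof.
rewrite discrete_probabilityE -w1; congr EFin; apply: eq_bigr => i _.
by rewrite indicT mulr1.
Qed.

HB.instance Definition _ :=
  Measure_isProbability.Build _ _ _ (discrete_probability w1)
    discrete_probability_setT.

Lemma ge0_integral_discrete_probability (f : T -> \bar R) :
  measurable_fun setT f -> (forall t, (0 <= f t)%E) ->
  (\int[discrete_probability w1]_t f t = \sum_i (w i)%:num%:E * f (x i))%E.
Proof.
move=> mf f0; rewrite ge0_integral_measure_sum//.
rewrite [RHS](reindex _ (onW_bij _ (@enum_val_bij I))).
apply: eq_bigr => k _; rewrite /discrete_summand valK.
by rewrite ge0_integral_mscale// integral_dirac// diracT mul1e.
Qed.

Lemma integral_discrete_probability (f : T -> R) : measurable_fun setT f ->
  (\int[discrete_probability w1]_t (f t)%:E =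
   (\sum_i (w i)%:num * f (x i))%R%:E)%E.
Proof.
move=> /measurable_EFinP mf; rewrite integralE.
rewrite !ge0_integral_discrete_probability//; last 2 first.
- exact: measurable_funeneg.
- exact: measurable_funepos.
rewrite (eq_bigr (fun i => ((w i)%:num * Num.max (f (x i)) 0)%:E));
  last first.
  by move=> i _; rewrite funeposE -EFin_max.
rewrite [X in (_ - X)%E](eq_bigr
  (fun i => ((w i)%:num * Num.max (- f (x i)) 0)%:E)); last first.
  by move=> i _; rewrite funenegE -EFin_max.
rewrite !sumEFin -EFinB; congr EFin; rewrite -sumrB; apply: eq_bigr => i _.
rewrite -mulrBr; congr (_ * _).
by have [f0|f0] := leP 0 (f (x i)); [rewrite max_r ?subr0|rewrite max_l]; lra.
Qed.

(** As [f] need not be measurable, it is bounded below by [g], equal to [f] on the atoms and to [c]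
    elsewhere. This [g] is constant off a finite set, hence measurable. The inequality suffices to
    bound payoffs by the worst case. *)
Lemma expectation_discrete_probability (f : T -> R) (c : R) :
  (forall t : T, measurable [set t]) -> (forall t, c <= f t) ->
  ((\sum_i (w i)%:num * f (x i))%R%:E <= 'E_(discrete_probability w1)[f])%E.
Proof.
move=> m1 cf; rewrite expectation.unlock.
pose g t := if t \in range x then f t else c.
have -> : \sum_i (w i)%:num * f (x i) = \sum_i (w i)%:num * g (x i).
  by apply: eq_bigr => i _; rewrite /g mem_set//; exists i.
rewrite -integral_discrete_probability.
  apply: le_integral_pointwise => t; rewrite lee_fin /g.
  by case: ifP.
apply: (@measurable_fun_cst_off _ _ _ _ (range x) c) => //.
  exact/finite_set_countable/finite_image/finite_finset.
by move=> t xt; rewrite /g memNset.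
Qed.

End discrete_probability.

(** * Existence of the multiplier *)

Lemma lagrange_multiplier (R : realType) (S : Type) (c y : S -> R) (r V : R)
    (s0 : S) : c s0 < r ->
  (forall s s' t, 0 <= t <= 1 -> t * c s + (1 - t) * c s' <= r ->
     t * y s + (1 - t) * y s' <= V) ->
  exists2 l, 0 <= l & forall s, y s + l * (r - c s) <= V.
Proof.
move=> cs0 mix.
have pure s : c s <= r -> y s <= V.
  by move=> csr; have := mix s s 1; lra.
have slope s s' : c s < r -> r < c s' ->
    (y s' - V) / (c s' - r) <= (V - y s) / (r - c s).
  move=> csr csr'.
  have D : 0 < c s' - c s by lra.
  (* This weight makes the mean cost of the mixture exactly [r]. *)
  pose t := (c s' - r) / (c s' - c s).
  have tD : t * (c s' - c s) = c s' - r by rewrite /t divfK//; lra.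
  have t01 : 0 <= t <= 1.
    rewrite /t ler_pdivlMr// ler_pdivrMr//; lra.
  have := mix s s' t t01; have -> : t * c s + (1 - t) * c s' = r by nra.
  move=> /(_ (lexx _)) h.
  have {}h := ler_wpM2r (ltW D) h.
  rewrite ler_pdivrMr; last lra.
  rewrite mulrAC ler_pdivlMr; last lra.
  have E : (t * y s + (1 - t) * y s') * (c s' - c s) =
    (t * (c s' - c s)) * y s + ((c s' - c s) - t * (c s' - c s)) * y s' by ring.
  by move: h; rewrite E tD; lra.
(* The multiplier is the largest slope to the right of [r]. Adding 0 makes it nonnegative and covers
   the case of no such slope; [s0], strictly below [r], bounds [A] from above. *)
pose A := [set 0] `|` [set (y s - V) / (c s - r) | s in [set s | r < c s]].
have ubA s : c s < r -> ubound A ((V - y s) / (r - c s)).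
  move=> csr _ [->|[s' /= rs' <-]]; last exact: slope.
  by apply: divr_ge0; [rewrite subr_ge0 pure// ltW|lra].
have supA : has_sup A.
  split; first by exists 0; left.
  by exists ((V - y s0) / (r - c s0)); exact: ubA.
exists (sup A) => [|s]; first by apply: sup_upper_bound => //; left.
have [csr|csr|csr] := ltgtP (c s) r.
- have : sup A <= (V - y s) / (r - c s).
    by apply: ge_sup => //; [exact: supA.1|exact: ubA].
  by rewrite ler_pdivlMr ?subr_gt0//; lra.
- have : (y s - V) / (c s - r) <= sup A.
    by apply: sup_upper_bound => //; right; exists s.
  by rewrite ler_pdivrMr ?subr_gt0//; lra.
- by rewrite csr subrr mulr0 addr0 pure ?csr.
Qed.

(** * Change of variables along the marginals of a coupling *)

Lemma integrable_bounded_probability disp (T : measurableType disp)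
    (R : realType) (P : probability T R) (f : T -> R) (a b : R) :
  measurable_fun setT f -> (forall x, a <= f x <= b) ->
  P.-integrable setT (EFin \o f).
Proof.
move=> mf fab; apply: measurable_bounded_integrable => //.
  by rewrite [X in (X < _)%E]probability_setT ltry.
exists (`|a| + `|b|); split; first exact: num_real.
move=> M ltM x _ /=; rewrite (le_trans _ (ltW ltM))// ler_norml.
have /andP[af fb] := fab x.
have := ler_norm (- a); have := ler_norm b; have := normr_ge0 a.
have := normr_ge0 b; rewrite normrN; lra.
Qed.

Section couplings.
Context disp (T : measurableType disp) (R : realType).
Variables (P1 P2 : probability T R) (K : probability (T * T)%type R).
Hypothesis KP : couplings P1 P2 K.

(** [P1] is the image of [K] under the first projection; the bounds on [g] provide the integrability
    that the change of variables asks for. *)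
Lemma integral_coupling_fst (g : T -> R) (a b : R) : measurable_fun setT g ->
  (forall x, a <= g x <= b) ->
  (\int[P1]_x (g x)%:E = \int[K]_z (g z.1)%:E)%E.
Proof.
move=> mg gab.
rewrite -[RHS]/(\int[K]_(z in fst @^-1` setT) ((EFin \o g) \o fst) z)%E.
rewrite -integral_pushforward//.
- apply: eq_measure_integral => A mA _.
  by apply: etrans (esym (KP mA).1) _; rewrite setXT.
- exact/measurable_EFinP.
- rewrite preimage_setT.
  apply: (@integrable_bounded_probability _ _ _ _ (g \o fst) a b) => [|z];
    last exact: gab.
  exact: measurableT_comp.
Qed.

Lemma integral_coupling_snd (g : T -> R) (a b : R) : measurable_fun setT g ->
  (forall x, a <= g x <= b) ->
  (\int[P2]_x (g x)%:E = \int[K]_z (g z.2)%:E)%E.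
Proof.
move=> mg gab.
rewrite -[RHS]/(\int[K]_(z in snd @^-1` setT) ((EFin \o g) \o snd) z)%E.
rewrite -integral_pushforward//.
- apply: eq_measure_integral => A mA _.
  by apply: etrans (esym (KP mA).2) _; rewrite setTX.
- exact/measurable_EFinP.
- rewrite preimage_setT.
  apply: (@integrable_bounded_probability _ _ _ _ (g \o snd) a b) => [|z];
    last exact: gab.
  exact: measurableT_comp.
Qed.

End couplings.

(** * Transport to the empirical distribution *)

(** The coupling sends the atom [x i] to [y i] with mass [w i]. [P] only has to agree with a
    discrete measure on measurable sets, which makes the bound applicable to [P0]. *)
Lemma wasserstein_discrete_le disp (T : measurableType disp) (R : realType)
    (I : finType) (w : I -> {nonneg R}) (w1 : \sum_i (w i)%:num = 1)
    (x y : I -> T) (d : T -> T -> R) (P : probability T R) :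
  measurable_fun setT (fun z : T * T => d z.1 z.2) ->
  (forall s t, 0 <= d s t) ->
  (forall A, measurable A -> P A = discrete_probability y w1 A) ->
  (wasserstein d (discrete_probability x w1) P <=
   (\sum_i (w i)%:num * d (x i) (y i))%R%:E)%E.
Proof.
move=> md d0 Py; apply: ereal_inf_lbound.
exists (discrete_probability (fun i => (x i, y i)) w1).
  move=> A mA; rewrite Py//.
  by split; apply: etrans (discrete_probabilityE _ w1 _)
      (etrans _ (esym (discrete_probabilityE _ w1 _)));
    congr EFin; apply: eq_bigr => i _;
    rewrite !indicE !in_setX !in_setT ?andbT.
by rewrite integral_discrete_probability.
Qed.

(** The atoms inside [A] give a lower bound for [P A]. The same bound for the complement is an upper
    bound for [P A], and the two coincide because the atoms carry total mass 1. *)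
Lemma empirical_probabilityE disp (T : measurableType disp) (R : realType)
    (m : nat) (xi : 'I_m -> T) (P : probability T R) :
  (forall t : T, measurable [set t]) -> (0 < m)%N -> injective xi ->
  (forall i, P [set xi i] = (m%:R^-1)%:E) ->
  forall A, measurable A -> P A = (\sum_i m%:R^-1 * \1_A (xi i))%:E.
Proof.
move=> m1 m0 xi_inj Pxi.
have lower A : measurable A -> ((\sum_i m%:R^-1 * \1_A (xi i))%R%:E <= P A)%E.
  move=> mA; pose D := [set i | A (xi i)].
  have DA : \bigcup_(i in D) [set xi i] `<=` A by move=> _ [i Di ->].
  have mD : measurable (\bigcup_(i in D) [set xi i]).
    by apply: fin_bigcup_measurable => //; exact: finite_finset.
  apply: le_trans (le_measure P _ _ DA); rewrite ?inE//.
  rewrite measure_fin_bigcup//; last first.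
  - by move=> i j _ _ [t [-> /xi_inj]].
  - exact: finite_finset.
  rewrite fsbig_mkcond (fsbigE (index_enum 'I_m)) ?index_enum_uniq//;
    last first.
    by move=> i _; rewrite mem_index_enum.
  rewrite -sumEFin [leRHS]big_mkcond; apply: lee_sum => i _.
  have iD : (i \in D) = (xi i \in A).
    by apply/idP/idP => /set_mem ?; exact/mem_set.
  rewrite in_setT /patch indicE iD.
  by case: ifP => _ /=; rewrite ?mulr0// mulr1 -(Pxi i).
move=> A mA; have mCA := measurableC mA.
have PA := probability_setC P mA.
apply/eqP; rewrite eq_le lower// andbT.
have /= := lower _ mCA; rewrite PA.
have [r Pr] : exists r, P A = r%:E.
  by exists (fine (P A)); rewrite fineK// fin_num_measure.
rewrite Pr -EFinB !lee_fin.
have : \sum_i m%:R^-1 * \1_A (xi i) +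
    \sum_i m%:R^-1 * \1_(~` A) (xi i) = 1 :> R.
  rewrite -big_split/= (eq_bigr (fun=> m%:R^-1)).
    by rewrite sumr_const card_ord -[LHS]mulr_natl divff// pnatr_eq0 -lt0n.
  move=> i _; rewrite !indicE in_setC.
  by case: (_ \in _); rewrite /= mulr1 mulr0 ?addr0 ?add0r.
lra.
Qed.

Lemma expectation_bounds disp (T : measurableType disp) (R : realType)
    (P : probability T R) (f : T -> R) (a b : R) :
  (forall x, a <= f x <= b) -> (a%:E <= 'E_P[f] <= b%:E)%E.
Proof.
move=> fab; rewrite -[a%:E](expectation_cst P) -[b%:E](expectation_cst P).
by rewrite expectation.unlock; apply/andP; split;
  apply: le_integral_pointwise => x; rewrite lee_fin; case/andP: (fab x).
Qed.

(** * Weak and strong duality for a fixed decision *)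

Section duality.
Context disp (T : measurableType disp) (R : realType) (m : nat).
Variables (d : T -> T -> R) (xi : 'I_m -> T) (P0 : probability T R) (r0 : R).
Hypothesis measurable_singleton : forall t : T, measurable [set t].
Hypothesis m_gt0 : (0 < m)%N.
Hypothesis xi_inj : injective xi.
Hypothesis P0_xi : forall i, P0 [set xi i] = (m%:R^-1)%:E.
Hypothesis d_ge0 : forall s t, 0 <= d s t.
Hypothesis measurable_d : measurable_fun setT (fun z : T * T => d z.1 z.2).

Let avg_cst (a : R) : m%:R^-1 * \sum_(i < m) a = a.
Proof.
by rewrite sumr_const card_ord -[X in _ * X]mulr_natl mulKf// pnatr_eq0 -lt0n.
Qed.

Let weight_ge0 : 0 <= m%:R^-1 :> R. Proof. by rewrite invr_ge0. Qed.
Let weight (i : 'I_m) : {nonneg R} := NngNum weight_ge0.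
Let weight1 : \sum_i (weight i)%:num = 1.
Proof.
by rewrite -[RHS]avg_cst mulr_sumr; apply: eq_bigr => i _; rewrite mulr1.
Qed.

Lemma integral_empirical (g : T -> R) : measurable_fun setT g ->
  (\int[P0]_x (g x)%:E = (m%:R^-1 * \sum_i g (xi i))%R%:E)%E.
Proof.
move=> mg; rewrite (eq_measure_integral (discrete_probability xi weight1)).
  by rewrite integral_discrete_probability// mulr_sumr.
move=> A mA _; rewrite /= discrete_probabilityE.
exact: empirical_probabilityE.
Qed.

(* [f] need not be measurable (a function which is Lipschitz for [d] may fail
   to be so for F), hence the measurable majorant [g] below: only its integral
   can be transported to the coupling [K]. *)
Lemma weak_duality (f : T -> R) (C1 C2 lam : R) (v : 'I_m -> R)
    (P : probability T R) :
  0 <= lam -> (forall s, C1 <= f s <= C2) -> (forall i, C1 <= v i <= C2) ->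
  (forall s i, f s <= v i + lam * d s (xi i)) ->
  (wasserstein d P P0 <= r0%:E)%E ->
  ('E_P[f] <= (m%:R^-1 * \sum_i v i + r0 * lam)%R%:E)%E.
Proof.
move=> lam0 fC vC2 fv Pr0; apply/lee_addgt0Pr => e e0.
(* Since [lam] may vanish, the slack in the transport cost is [e / (lam + 1)]; multiplied by [lam]
   it is at most [e]. *)
have lam1 : 0 < lam + 1 by lra.
have [|_ [K KP <-] Kd] := @ereal_inf_lt _
    [set (\int[K]_z (d z.1 z.2)%:E)%E | K in couplings P P0]
    (r0 + e / (lam + 1))%:E.
  by apply: le_lt_trans Pr0 _; rewrite lte_fin ltrDl divr_gt0.
pose g s := \big[Num.min/C2]_(i < m) (v i + lam * d s (xi i)).
have mg : measurable_fun setT g.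
  rewrite /g; elim: (index_enum 'I_m) => [|i s IH].
    by under eq_fun do rewrite big_nil; exact: measurable_cst.
  under eq_fun do rewrite big_cons.
  apply: measurable_minr => //; apply: measurable_funD => //.
  apply: measurable_funM => //.
  apply: (measurableT_comp (g := fun s => (s, xi i)) measurable_d) => /=.
  exact: measurable_fun_pair.
have fg s : f s <= g s.
  by apply: le_bigmin => [|i _]; [case/andP: (fC s)|].
have gC s : C1 <= g s <= C2.
  rewrite (le_trans _ (fg s)); last by case/andP: (fC s).
  exact: bigmin_le_id.
(* [V] extends [v] from the samples to all of [T]. The default [C2] bounds [g], so [gV] below holds
   everywhere and not only almost surely. *)
pose V t := if [pick i | xi i == t] is Some i then v i else C2.
have Vxi i : V (xi i) = v i.
  rewrite /V; case: pickP => [j /eqP/xi_inj->//|/(_ i)].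
  by rewrite eqxx.
have Vb t : C1 <= V t <= C2.
  by rewrite /V; case: pickP => // _; have := fC t; lra.
have mV : measurable_fun setT V.
  apply: (@measurable_fun_cst_off _ _ _ _ (range xi) C2) => //.
    exact/finite_set_countable/finite_image/finite_finset.
  move=> t xt; rewrite /V; case: pickP => // i /eqP E; case: xt.
  by exists i.
have gV z : g z.1 <= V z.2 + lam * d z.1 z.2.
  rewrite /V; case: pickP => [i /eqP <-|_].
    exact: bigmin_le.
  case/andP: (gC z.1) => _ /le_trans; apply; by rewrite lerDl mulr_ge0.
have d0E z : (0 <= (d z.1 z.2)%:E)%E by rewrite lee_fin.
have mdE : measurable_fun setT (fun z : T * T => (d z.1 z.2)%:E).
  exact/measurable_EFinP.
have id : K.-integrable setT (EFin \o (fun z => d z.1 z.2)).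
  apply/integrableP; split => //.
  under eq_integral => z _ do rewrite /= ger0_norm//.
  by rewrite (lt_trans Kd)// ltry.
have E1 : ('E_P[f] <= \int[P]_x (g x)%:E)%E.
  rewrite expectation.unlock.
  by apply: le_integral_pointwise => x; rewrite lee_fin.
apply: (le_trans E1); rewrite (integral_coupling_fst KP mg gC).
apply: (@le_trans _ _ (\int[K]_z ((V z.2)%:E + (lam * d z.1 z.2)%:E))%E).
  by apply: le_integral_pointwise => z; rewrite -EFinD lee_fin.
rewrite integralD_EFin//; last 2 first.
- apply: (@integrable_bounded_probability _ _ _ _ (V \o snd) C1 C2) => [|z];
    last exact: Vb.
  exact: measurableT_comp.
- exact: (integrableZl measurableT lam id).
rewrite -(integral_coupling_snd KP mV Vb) integral_empirical//.
rewrite (eq_bigr _ (fun i _ => Vxi i)).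
under [X in (_ + X)%E]eq_integral => z _ do rewrite /= EFinM.
rewrite ge0_integralZl//.
have : (\int[K]_z (d z.1 z.2)%:E \is a fin_num)%E.
  rewrite fin_numE gt_eqF ?lt_eqF// ?(lt_trans Kd) ?ltry//.
  by rewrite (lt_le_trans (ltNyr 0)) ?integral_ge0.
case: (\int[K]_z (d z.1 z.2)%:E)%E Kd => // k; rewrite lte_fin => Kd _.
rewrite -EFinM -!EFinD lee_fin.
have : lam * k <= lam * (r0 + e / (lam + 1)) by rewrite ler_wpM2l// ltW.
have : lam * (e / (lam + 1)) <= e.
  by rewrite mulrCA ger_pMr// ler_pdivrMr; lra.
rewrite mulrDr [r0 * lam]mulrC; lra.
Qed.

Section strong_duality.
Variables (f : T -> R) (C1 C2 V : R).
Hypothesis r0_gt0 : 0 < r0.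
Hypothesis dxx : forall s, d s s = 0.
Hypothesis f_bounds : forall s, C1 <= f s <= C2.
Hypothesis V_ub : forall P, wasserstein_ball d P0 r0 P -> ('E_P[f] <= V%:E)%E.

(** The diagonal coupling of the samples costs nothing. Nonemptiness keeps the worst-case value from
    being minus infinity. *)
Lemma wasserstein_ball_nonempty : wasserstein_ball d P0 r0 !=set0.
Proof.
exists (discrete_probability xi weight1) => /=.
apply: le_trans
  (@wasserstein_discrete_le _ _ _ _ _ weight1 xi xi d P0 _ _ _) _ => //.
  by move=> A mA; rewrite discrete_probabilityE; exact: empirical_probabilityE.
by rewrite big1 ?lee_fin ?ltW// => i _; rewrite dxx mulr0.
Qed.

(** Put mass [t / m] on each [s i] and [(1 - t) / m] on each [s' i], and transport both to [xi i]:
    the cost is the assumed sum, so this distribution lies in the ball. *)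
Lemma mixture_le (s s' : 'I_m -> T) (t : R) : 0 <= t <= 1 ->
  t * (m%:R^-1 * \sum_i d (s i) (xi i)) +
    (1 - t) * (m%:R^-1 * \sum_i d (s' i) (xi i)) <= r0 ->
  t * (m%:R^-1 * \sum_i f (s i)) + (1 - t) * (m%:R^-1 * \sum_i f (s' i)) <= V.
Proof.
move=> t01 costr0.
have w_ge0 (p : bool * 'I_m) : 0 <= (if p.1 then t else 1 - t) * m%:R^-1.
  by rewrite mulr_ge0//; case: p.1; lra.
pose w p : {nonneg R} := NngNum (w_ge0 p).
have sum_w (F : bool -> 'I_m -> R) : \sum_p (w p)%:num * F p.1 p.2 =
    t * (m%:R^-1 * \sum_i F true i) + (1 - t) * (m%:R^-1 * \sum_i F false i).
  rewrite -(pair_bigA _ (fun b i => (w (b, i))%:num * F b i))/= big_bool/=.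
  by rewrite !mulr_sumr; congr (_ + _); apply: eq_bigr => i _; rewrite mulrA.
have w1 : \sum_p (w p)%:num = 1.
  under eq_bigr do rewrite -[_%:num]mulr1.
  by rewrite (sum_w (fun _ _ => 1)) avg_cst !mulr1; lra.
pose x (p : bool * 'I_m) := if p.1 then s p.2 else s' p.2.
have : ('E_(discrete_probability x w1)[f] <= V%:E)%E.
  apply: V_ub => /=.
  apply: le_trans (@wasserstein_discrete_le _ _ _ _ _ w1
    x (fun p => xi p.2) d P0 _ _ _) _ => //.
    (* At each sample the two masses add up to [1 / m], so the second marginal is [P0]. *)
    move=> A mA; rewrite discrete_probabilityE.
    rewrite (sum_w (fun _ i => \1_A (xi i))).
    rewrite (empirical_probabilityE measurable_singleton m_gt0 xi_inj P0_xi)//.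
    by congr EFin; rewrite -mulr_sumr; ring.
  by rewrite lee_fin (sum_w (fun b i => d (if b then s i else s' i) (xi i))).
have fC1 u : C1 <= f u by case/andP: (f_bounds u).
move=> /(le_trans
  (expectation_discrete_probability x w1 measurable_singleton fC1)).
by rewrite lee_fin (sum_w (fun b i => f (if b then s i else s' i))).
Qed.

Lemma strong_duality : V <= C2 -> exists v : 'I_m -> R, exists lam : R,
  [/\ forall i, C1 <= v i <= C2,
      0 <= lam <= (C2 - C1) / r0,
      forall s i, f s <= v i + lam * d s (xi i) &
      m%:R^-1 * \sum_i v i + r0 * lam <= V].
Proof.
move=> VC2.
(* The choice [xi] costs 0, strictly less than [r0]. *)
have [|lam lam0 lamV] := @lagrange_multiplier R ('I_m -> T)
    (fun s => m%:R^-1 * \sum_i d (s i) (xi i))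
    (fun s => m%:R^-1 * \sum_i f (s i)) r0 V xi _ mixture_le.
  by rewrite big1 ?mulr0.
pose S i := [set f s - lam * d s (xi i) | s in [set: T]].
have S_ub i : ubound (S i) C2.
  move=> _ [s _ <-]; have := f_bounds s; have := mulr_ge0 lam0 (d_ge0 s (xi i)).
  lra.
have S_xi i : S i (f (xi i)) by exists (xi i) => //; rewrite dxx mulr0 subr0.
have S_sup i : has_sup (S i) by split; [exists (f (xi i))|exists C2].
pose v i := sup (S i).
have v_bounds i : C1 <= v i <= C2.
  rewrite ge_sup//; last by exists (f (xi i)).
  rewrite andbT (@le_trans _ _ (f (xi i)))//.
    by case/andP: (f_bounds (xi i)).
  exact: sup_upper_bound.
have vV : m%:R^-1 * \sum_i v i + r0 * lam <= V.
  apply/ler_addgt0Pr => e e0.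
  (* Near-maximizers are picked independently for each sample; [lamV] at the resulting choice bounds
     all the suprema at once. *)
  have /choice[s sv] i : exists s, v i - e < f s - lam * d s (xi i).
    by have [_ [s _ <-] ?] := sup_adherent e0 (S_sup i); exists s.
  apply: le_trans (lerD (lamV s) (lexx e)).
  suff : m%:R^-1 * \sum_i (v i - e) <=
      m%:R^-1 * \sum_i (f (s i) - lam * d (s i) (xi i)).
    by rewrite !sumrB !mulrBr avg_cst -mulr_sumr; lra.
  by rewrite ler_wpM2l//; apply: ler_sum => i _; exact: ltW.
exists v, lam; split => //.
(* The mean of [v] is at least [C1] and the dual objective at most [C2], which leaves at most
   [C2 - C1] for [r0 * lam]. *)
- rewrite lam0 ler_pdivlMr//.
  suff : C1 <= m%:R^-1 * \sum_i v i by lra.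
  rewrite -[leLHS]avg_cst ler_wpM2l//; apply: ler_sum => i _.
  by case/andP: (v_bounds i).
- move=> s i; rewrite -lerBlDr; apply: sup_upper_bound => //.
  by exists s.
Qed.

End strong_duality.

End duality.

(** * Compactness and attainment in the semi-infinite program *)

Section semi_infinite_program_compact.
Context {R : realType} {V : topologicalType} {T : choiceType} {m : nat}.
Variables (Theta : set V) (h : V -> T -> R) (d : T -> T -> R) (xi : 'I_m -> T).
Variables (C1 C2 r0 : R).
Hypothesis Theta_compact : compact Theta.
Hypothesis h_continuous : forall s, {within Theta, continuous (h ^~ s)}.

Lemma dual_box_compact : compact (dual_box C1 C2 r0 : set 'rV[R]_m.+1).
Proof.
(* The box is a product of segments; only the last index, [m], gets the multiplier bounds. *)
pose B (j : 'I_m.+1) : set R :=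
  if (j < m)%N then [set` `[C1, m.+1%:R * C2 - m%:R * C1]]
  else [set` `[0, (C2 - C1) / r0]].
have -> : dual_box C1 C2 r0 = [set v | forall j, B j (v ord0 j)].
  apply/seteqP; split=> [v [v1 v2] j|v vB].
    rewrite /B; case: ifP => jm /=; rewrite in_itv/=.
      have := v1 (Ordinal jm).
      by rewrite /v_sample (_ : widen_ord _ _ = j)//; exact: val_inj.
    rewrite (_ : j = ord_max)//; apply: val_inj => /=.
    by apply/eqP; rewrite eqn_leq -ltnS ltn_ord leqNgt jm.
  split=> [i|].
    by have := vB (widen_ord (leqnSn m) i); rewrite /B /= ltn_ord/= in_itv.
  by have := vB ord_max; rewrite /B /= ltnn/= in_itv.
apply: rV_compact => j; rewrite /B.
by case: ifP => _; exact: segment_compact.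
Qed.

Lemma snd_coord_continuous (j : 'I_m.+1) :
  continuous (fun x : V * 'rV[R]_m.+1 => x.2 ord0 j).
Proof.
move=> x; apply: (@cvg_comp _ _ _ snd (fun v : 'rV[R]_m.+1 => v ord0 j)).
  exact: cvg_snd.
exact: coord_continuous.
Qed.

(* The constraints cut out a closed subset of the subspace topology of
   [Theta `*` dual_box], as [h] is continuous on [Theta] only. *)
Lemma sip_feasible_compact : compact (sip_feasible Theta h d xi C1 C2 r0).
Proof.
pose box : set 'rV[R]_m.+1 := dual_box C1 C2 r0.
pose A := Theta `*` box.
have cA : compact A := compact_setX Theta_compact dual_box_compact.
pose g (p : T * 'I_m) (x : V * 'rV[R]_m.+1) : R :=
  h x.1 p.1 - v_sample x.2 p.2 - v_last x.2 * d p.1 (xi p.2).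
have cg p : {within A, continuous (g p)}.
  apply/subspace_continuousP => x [Tx _].
  have c2 (j : 'I_m.+1) :
      (fun y : V * 'rV[R]_m.+1 => y.2 ord0 j) @ within A (nbhs x) -->
      x.2 ord0 j.
    by apply: cvg_within_filter; exact: snd_coord_continuous.
  apply: cvgB; [apply: cvgB|].
  (* Continuity within [Theta] pulls back along the first projection, which maps [A] into
     [Theta]. *)
  - have /subspace_continuousP/(_ _ Tx) := h_continuous (s := p.1).
    apply: cvg_trans => P /= hP.
    have cf : y.1 @[y --> x] --> x.1 by exact: cvg_fst.
    have : nbhs x (fst @^-1` [set y | Theta y -> P (h y p.1)]) := cf _ hP.
    by apply: filterS => z + [/= Tz _]; exact.
  - exact: c2.
  - by apply: cvgM; [exact: c2|exact: cvg_cst].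
have -> : sip_feasible Theta h d xi C1 C2 r0 =
    \bigcap_p (g p @^-1` [set y | y <= 0]) `&` A.
  apply/seteqP; split=> [[th v] [hv Tth vb]|[th v] [hv [Tth vb]]].
    by split=> // -[s i] _; exact: hv.
  by split => // s i; exact: (hv (s, i)).
(* For subsets of [A], compactness in the product and in the subspace topology agree. *)
apply/compact_subspaceIP.
apply: (@subclosed_compact (subspace A) _ A).
- apply: closedI; last exact: closed_subspaceT.
  apply: closed_bigI => p _; apply: (@preimage_closed (subspace A)).
    by move=> x _; exact: cg.
  exact: closed_le.
- by have := (@compact_subspaceIP _ A A).2; rewrite setIid; exact.
- by move=> x [].
Qed.

Lemma sip_optimal_solution_exists :
  sip_feasible Theta h d xi C1 C2 r0 !=set0 ->
  exists x, optimal_solution (sip_feasible Theta h d xi C1 C2 r0)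
    (sip_objective r0) x.
Proof.
move=> D0.
have [|x xD xmin] := @compact_EVT_min _ R
  (fun x : V * 'rV[R]_m.+1 =>
     m%:R^-1 * \sum_(i < m) v_sample x.2 i + r0 * v_last x.2)
  _ D0 sip_feasible_compact.
  apply: continuous_subspaceT => x.
  apply: cvgD; apply: cvgM;
    [exact: cvg_cst| |exact: cvg_cst|exact: snd_coord_continuous].
  apply: cvg_big => [|i _]; first exact: add_continuous.
  exact: snd_coord_continuous.
exists x; split; first exact/set_mem.
by move=> y Dy; rewrite lee_fin; exact/xmin/mem_set.
Qed.

End semi_infinite_program_compact.

(** * Equivalence of the two programs *)

Theorem corollary3p8 (R : realType) (n m : nat)
  (Xi : set 'rV[R]_n) (F : set (set Xi))
  (Xi0 : Xi !=set0) (hF : sigma_algebra [set: Xi] F)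
  (F_singleton : forall s : Xi, F [set s])
  (d : sample_space Xi0 hF -> sample_space Xi0 hF -> R)
  (d_metric : is_metric d)
  (d_measurable : measurable_fun setT
     (fun z : sample_space Xi0 hF * sample_space Xi0 hF => d z.1 z.2))
  (m_gt0 : (0 < m)%N)
  (xi : 'I_m -> sample_space Xi0 hF) (xi_inj : injective xi)
  (P0 : probability (sample_space Xi0 hF) R)
  (P0_empirical : forall i : 'I_m, P0 [set xi i] = (m%:R^-1)%:E)
  (r0 : R) (r0_gt0 : 0 < r0)
  (Theta : set 'rV[R]_n)
  (Theta_compact : compact Theta) (Xi_compact : compact Xi)
  (h : 'rV[R]_n -> sample_space Xi0 hF -> R)
  (h_continuous : forall s, {within Theta, continuous (fun theta => h theta s)})
  (C1 C2 : R)
  (h_bounded : forall theta s, Theta theta -> C1 <= h theta s <= C2)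
  (h_lipschitz : forall theta, Theta theta -> exists2 C : R, 0 < C &
     forall s1 s2, `|h theta s1 - h theta s2| <= C * d s1 s2) :
  let wro_objective := worst_case h (wasserstein_ball d P0 r0) in
  let feasible := sip_feasible Theta h d xi C1 C2 r0 in
  let objective := sip_objective r0 in
  [/\ optimal_value Theta wro_objective = optimal_value feasible objective,
      forall theta, optimal_solution Theta wro_objective theta <->
        exists v, optimal_solution feasible objective (theta, v) &
      Theta !=set0 -> exists x, optimal_solution feasible objective x].
Proof.
move=> wro feasible objective; have [d_ge0 d_eq0 _ _] := d_metric.
have mS (t : sample_space Xi0 hF) : measurable [set t] := F_singleton t.
have dxx s : d s s = 0 by apply/d_eq0.
have weak theta v : feasible (theta, v) ->
    (wro theta <= objective (theta, v))%E.
  case=> /= hv Theta_theta [v1 /andP[v2 _]].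
  (* [weak_duality] takes common bounds for [f] and [v]. The upper end of the box exceeds [C2] by
     [m * (C2 - C1)], so it bounds [h theta] as well. *)
  have h_le s : C1 <= h theta s <= m.+1%:R * C2 - m%:R * C1.
    have /andP[h1 h2] := h_bounded theta s Theta_theta; rewrite h1/=.
    have : 0 <= m%:R * (C2 - C1) by rewrite mulr_ge0// subr_ge0 (le_trans h1).
    by rewrite -natr1; lra.
  apply: ge_ereal_sup => _ [P PB <-].
  apply: (@weak_duality _ _ _ _ _ _ _ _ mS m_gt0 xi_inj P0_empirical
    d_ge0 d_measurable (h theta) _ _ _ (v_sample v) P v2 h_le v1 _ PB) => s i.
  by have := hv s i; lra.
have strong theta : Theta theta ->
    exists v, feasible (theta, v) /\ (objective (theta, v) <= wro theta)%E.
  move=> Theta_theta; have hb s := h_bounded theta s Theta_theta.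
  have C12 : C1 <= C2.
    by have /andP[h1] := hb (xi (Ordinal m_gt0)); exact: le_trans.
  have [P PB] := wasserstein_ball_nonempty mS m_gt0 xi_inj P0_empirical
    d_ge0 d_measurable r0_gt0 dxx.
  have wroC2 : (wro theta <= C2%:E)%E.
    by apply: ge_ereal_sup => _ [Q _ <-]; case/andP: (expectation_bounds Q hb).
  have wroC1 : (C1%:E <= wro theta)%E.
    have /andP[E1 _] := expectation_bounds P hb.
    by apply: le_trans E1 _; apply: ereal_sup_ubound; exists P.
  (* Lying between [C1] and [C2], the worst-case value is real and can serve as [V] in
     [strong_duality]. *)
  have wroE : wro theta = (fine (wro theta))%:E.
    rewrite fineK// fin_numE gt_eqF ?lt_eqF ?(lt_le_trans (ltNyr C1))//.
    by rewrite (le_lt_trans wroC2)// ltry.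
  have [Q QB||v [lam [v_bounds lam_bounds hv v_obj]]] :=
    strong_duality mS m_gt0 xi_inj P0_empirical d_ge0 d_measurable
      r0_gt0 dxx hb (V := fine (wro theta)).
  - by rewrite -wroE; apply: ereal_sup_ubound; exists Q.
  - by rewrite -lee_fin -wroE.
  (* [insub] fails only at the last index, where the default [lam] is taken. *)
  pose u : 'rV[R]_m.+1 := \row_j oapp v lam (insub (j : nat)).
  have uv i : v_sample u i = v i by rewrite /v_sample mxE/= valK.
  have ul : v_last u = lam by rewrite /v_last mxE/= insubN// ltnn.
  exists u; split; last first.
    rewrite /objective /sip_objective/= wroE lee_fin ul.
    by rewrite (eq_bigr _ (fun i _ => uv i)).
  split => //= [s i|].
    by rewrite uv ul; have := hv s i; lra.
  split=> [i|]; last by rewrite ul.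
  rewrite uv; have /andP[-> v2] := v_bounds i; rewrite /=.
  have : 0 <= m%:R * (C2 - C1) by rewrite mulr_ge0// subr_ge0.
  by rewrite -natr1; lra.
have feasible_Theta theta v : feasible (theta, v) -> Theta theta by case.
split.
- apply/eqP; rewrite eq_le; apply/andP; split.
    apply: le_ereal_inf_tmp => _ [[theta v] fv <-].
    apply: le_trans (weak _ _ fv); apply: ereal_inf_lbound.
    by exists theta => //; exact: feasible_Theta fv.
  apply: le_ereal_inf_tmp => _ [theta Ttheta <-].
  have [v [fv ov]] := strong _ Ttheta.
  by apply: le_trans ov; apply: ereal_inf_lbound; exists (theta, v).
- move=> theta; split.
    (* The chain is: objective at [(theta, v)], worst case at [theta], worst case at [theta'],
       objective at [(theta', v')]. The converse interleaves them the other way. *)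
    case=> Ttheta theta_min; have [v [fv ov]] := strong _ Ttheta.
    exists v; split => // -[theta' v'] fv'.
    apply: le_trans ov (le_trans (theta_min _ (feasible_Theta _ _ fv')) _).
    exact: weak.
  case=> v [fv v_min]; split; first exact: feasible_Theta fv.
  move=> theta' Ttheta'; have [v' [fv' ov']] := strong _ Ttheta'.
  exact: le_trans (weak _ _ fv) (le_trans (v_min _ fv') ov').
- case=> theta /strong[v [fv _]]; apply: sip_optimal_solution_exists => //.
  by exists (theta, v).
Qed.
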